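(* Let $(X,d,\mu)$ be a complete metric measure space, where $\mu$ is a doubling measure, and let $\{(X_\alpha,\mathbf{x}_\alpha)\}_{\alpha\in\Lambda}$ be an approximate differentiable structure on $(X,d,\mu)$. Let $f:X\to\mathbb{R}$ be a $\mu$-measurable function and let $E\subset X$ be a bounded measurable subset. Then $f$ is approximately differentiable $\mu$-a.e. in $E$ if and only if $$\operatorname{ap\,limsup}_{y\to x}\frac{|f(y)-f(x)|}{d(x,y)}<\infty\qquad\text{for }\mu\text{-a.e. }x\in E.$$
   Context: A metric measure space $(X,d,\mu)$ is a separable metric space $(X,d)$ with a non-trivial, locally finite Borel regular measure $\mu$. $B(x,r)=\{y\in X: d(x,y)<r\}$. The measure $\mu$ is doubling if there is $C_\mu>0$ with $\mu(B(x,2r))\le C_\mu\,\mu(B(x,r))$ for all $x\in X$, $r>0$. A point $x$ is a density point of a $\mu$-measurable set $A$ if $\lim_{r\to0}\mu(B(x,r)\cap A)/\mu(B(x,r))=1$; $A$ has density zero at $x$ if this limit is $0$. We write $\operatorname{ap\,lim}_{y\to x}F(y)=l$ if for every $\varepsilon>0$ the point $x$ is a density point of $\{y:|F(y)-l|<\varepsilon\}$. $\operatorname{ap\,limsup}_{y\to x}F(y)$ is the infimum of the set of $a\in\mathbb{R}$ for which $\{y:F(y)>a\}$ has density zero at $x$. An approximate differentiable structure on $(X,d,\mu)$ is a countable collection $\{(X_\alpha,\mathbf{x}_\alpha)\}_{\alpha\in\Lambda}$ of measurable sets $X_\alpha\subset X$ and Lipschitz maps $\mathbf{x}_\alpha=(x_\alpha^1,\dots,x_\alpha^{N(\alpha)}):X\to\mathbb{R}^{N(\alpha)}$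 such that: (i) $\mu(X\setminus\bigcup_\alpha X_\alpha)=0$; (ii) there is $N\ge0$ with $N(\alpha)\le N$ for all $\alpha$; (iii) for every Lipschitz $f:X\to\mathbb{R}$ and every $\alpha$ there is a unique (up to a set of measure zero) measurable bounded function $d^\alpha f:X_\alpha\to\mathbb{R}^{N(\alpha)}$ such that for $\mu$-a.e. $x\in X_\alpha$ $$\operatorname{ap\,lim}_{y\to x}\frac{|f(y)-f(x)-d^\alpha f(x)\cdot(\mathbf{x}_\alpha(y)-\mathbf{x}_\alpha(x))|}{d(x,y)}=0.$$ A function $f:X\to\mathbb{R}$ is approximately differentiable at $x\in X_\alpha$ (with respect to $(X_\alpha,\mathbf{x}_\alpha)$) if there is a vector $L^\alpha f(x)\in\mathbb{R}^{N(\alpha)}$ such that $$\operatorname{ap\,lim}_{y\to x}\frac{|f(y)-f(x)-L^\alpha f(x)\cdot(\mathbf{x}_\alpha(y)-\mathbf{x}_\alpha(x))|}{d(x,y)}=0.$$ *)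

(* Defs.v *)
From HB Require Import structures.
From mathcomp Require Import all_boot all_order all_algebra.
From mathcomp Require Import all_classical all_reals all_analysis.
Set Implicit Arguments.
Unset Strict Implicit.
Unset Printing Implicit Defensive.
Import Order.TTheory GRing.Theory Num.Theory.
Import numFieldNormedType.Exports.

Local Open Scope classical_set_scope.
Local Open Scope ring_scope.

(* The library's complete uniform spaces are pointed; this costs nothing here,
   since a space carrying a nonzero measure is inhabited. *)
#[short(type="completeMetricType")]
HB.structure Definition CompleteMetric (R : numDomainType) :=
  { T of Metric R T & Complete T }.

Section MetricMeasureSpace.
Context {R : realType} {X : completeMetricType R}.

(* As usual in geometric measure theory, a "Borel regular measure" is an outer
   measure on all subsets of X, and "measurable" means Caratheodory
   measurable. *)
Record metric_measure_space (mu : {outer_measure set X -> \bar R}) : Prop := {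
  mms_separable : exists2 D : set X, countable D & dense D ;
  mms_nontrivial : (0 < mu [set: X])%E ;
  mms_locally_finite : forall x : X,
    exists2 r : R, 0 < r & (mu (ball x r) < +oo)%E ;
  mms_borel : <<s @open X >> `<=` mu.-caratheodory ;
  mms_regular : forall A : set X, exists B : set X,
    [/\ <<s @open X >> B, A `<=` B & mu A = mu B] }.

Definition doubling (mu : {outer_measure set X -> \bar R}) : Prop :=
  exists2 C : R, 0 < C &
    forall (x : X) (r : R), 0 < r ->
      (mu (ball x (2 * r)) <= C%:E * mu (ball x r))%E.

Variable mu : {outer_measure set X -> \bar R}.

Definition mu_measurable (A : set X) : Prop := mu.-cara.-measurable A.

Definition mu_measurable_fun (A : set X) (f : X -> R) : Prop :=
  measurable_fun (A : set (caratheodory_type mu)) f.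

Definition ae_in (A : set X) (P : X -> Prop) : Prop :=
  \forall x \ae (mu : set (caratheodory_type mu) -> \bar R), A x -> P x.

Definition has_density (A : set X) (x : X) (t : \bar R) : Prop :=
  (mu (ball x r `&` A) / mu (ball x r))%E @[r --> 0^'+] --> t.

Definition density_point (A : set X) (x : X) : Prop := has_density A x 1%E.

Definition density_zero (A : set X) (x : X) : Prop := has_density A x 0%E.

Definition ap_lim (F : X -> R) (x : X) (l : R) : Prop :=
  forall e : R, 0 < e -> density_point [set y | `|F y - l| < e] x.

Definition ap_limsup (F : X -> R) (x : X) : \bar R :=
  ereal_inf [set a%:E | a in [set a : R | density_zero [set y | a < F y] x]].

End MetricMeasureSpace.

Section ApproximateDifferentiability.
Context {R : realType} {X : completeMetricType R}.
Variable mu : {outer_measure set X -> \bar R}.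

(* The norm on row vectors is the sup norm, which is equivalent to the
   Euclidean one. *)
Definition lipschitz_map (V : normedZmodType R) (f : X -> V) : Prop :=
  exists K : R, forall x y : X, `|f x - f y| <= K * mdist x y.

Definition dotv n (u v : 'rV[R]_n) : R := \sum_(i < n) u 0 i * v 0 i.

(* The quotients below take the value 0 at y = x (total division), so that
   the conditions on them hold trivially at isolated points of X. *)
Definition diff_quotient (f : X -> R) (x y : X) : R :=
  `|f y - f x| / mdist x y.

Definition remainder_quotient n (g : X -> 'rV[R]_n) (f : X -> R)
    (L : 'rV[R]_n) (x y : X) : R :=
  `|f y - f x - dotv L (g y - g x)| / mdist x y.

Definition approx_gradient n (g : X -> 'rV[R]_n) (f : X -> R) (x : X)
    (L : 'rV[R]_n) : Prop :=
  ap_lim mu (remainder_quotient g f L x) x 0.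

Definition approx_differentiable n (g : X -> 'rV[R]_n) (f : X -> R) (x : X) :
  Prop := exists L : 'rV[R]_n, approx_gradient g f x L.

(* Only the restriction of [D] to the chart [U] matters. *)
Definition is_approx_differential n (U : set X) (g : X -> 'rV[R]_n)
    (f : X -> R) (D : X -> 'rV[R]_n) : Prop :=
  [/\ forall i : 'I_n, mu_measurable_fun mu U (fun x => D x 0 i),
      [bounded D x | x in U]
    & ae_in mu U (fun x => approx_gradient g f x (D x))].

Record approx_diff_structure (Lambda : countType) (N : Lambda -> nat)
    (U : Lambda -> set X) (g : forall a, X -> 'rV[R]_(N a)) : Prop := {
  ads_measurable : forall a, mu_measurable mu (U a) ;
  ads_lipschitz : forall a, lipschitz_map (g a) ;
  ads_cover : mu (~` \bigcup_a U a) = 0%E ;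
  ads_dim : exists M : nat, forall a, (N a <= M)%N ;
  ads_differential : forall f : X -> R, lipschitz_map f -> forall a,
    exists2 D : X -> 'rV[R]_(N a), is_approx_differential (U a) (g a) f D &
      forall D' : X -> 'rV[R]_(N a),
        is_approx_differential (U a) (g a) f D' ->
        ae_in mu (U a) (fun x => D' x = D x) }.

(* Charts may overlap: differentiability is required with respect to every
   chart containing the point. *)
Definition approx_differentiable_ae (Lambda : countType) (N : Lambda -> nat)
    (U : Lambda -> set X) (g : forall a, X -> 'rV[R]_(N a))
    (f : X -> R) (E : set X) : Prop :=
  ae_in mu E (fun x => forall a, U a x -> approx_differentiable (g a) f x).

End ApproximateDifferentiability.

(* Main.v *)
Require Import Defs.
From HB Require Import structures.
From mathcomp Require Import all_boot all_order all_algebra.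
From mathcomp Require Import all_classical all_reals all_analysis.
From mathcomp Require Import measurable_realfun ring lra.
Import Order.TTheory GRing.Theory Num.Theory.
Import numFieldNormedType.Exports.
Local Open Scope classical_set_scope.
Local Open Scope ring_scope.

(** If f has approximate gradient L at x, then off a set of density zero the
    difference quotient of f at x is at most 1 plus the Lipschitz bound of
    y |-> L . (g y - g x), so its approximate limsup is finite.  Passing from a
    density point of a set to density zero of its complement uses that the set
    is measurable, hence the measurability of f
    ([approx_gradient_ap_limsup]).

    The converse reduces f to Lipschitz functions, for which the structure
    provides differentials.  Where the approximate limsup is finite, the
    difference quotient is at most some integer k except on a small fraction of
    every small enough ball around x.  For two such points x and y at small
    distance r, with the same k and the same scale, the bad sets of x and of y
    together cannot fill the ball of radius r around x, so some z is good for
    both and |f x - f y| <= k (d(x, z) + d(z, y)) <= 3 k r.  Cutting by scale, k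
    and small balls, the points with finite approximate limsup are covered by
    countably many pieces S on which f is Lipschitz
    ([stepanov_decomposition]).  Extend f from S to a Lipschitz F.  At almost
    every x in S that lies in a chart, F has an approximate gradient and x is a
    density point of S; since f = F on S, the same vector is an approximate
    gradient of f ([lipschitz_piece_differentiable]).

    The pieces S come without measurability.  This is harmless because the
    density theorem holds for the outer measure of arbitrary sets: a set A of
    finite measure and its Borel hull H have the same measure inside every ball,
    and the points of A where H fails to have density one are covered by balls
    carrying a fixed proportion of their mass in U \ H, where U is an open set
    containing H with mu (U \ H) small; the doubling condition turns this into a
    bound on the measure of these points ([covering_bound],
    [density_theorem]). *)

Set Implicit Arguments.
Unset Strict Implicit.
Unset Printing Implicit Defensive.

(** * Balls and Lipschitz maps in a metric space *)

Section Balls.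
Context {R : realType} {X : completeMetricType R}.
Implicit Types (x y : X) (r s : R).

Lemma ballE x r y : ball x r y = (mdist x y < r) :> Prop.
Proof. by rewrite ballEmdist. Qed.

Lemma subset_ball x y r s : mdist x y + r <= s -> ball y r `<=` ball x s.
Proof.
move=> h z; rewrite !ballE => yz; apply: le_lt_trans (metric_triangle x y z) _.
by apply: lt_le_trans h; rewrite ltrD2l.
Qed.

Lemma open_ball x r : open (ball x r).
Proof.
rewrite openE => y; rewrite ballE => xy; apply/nbhs_ballP.
exists (r - mdist x y); first by rewrite /= subr_gt0.
by apply: subset_ball; rewrite addrC subrK.
Qed.

Lemma bigcup_ball x : \bigcup_n ball x n%:R = [set: X].
Proof.
rewrite -subTset => y _; exists (Num.truncn (mdist x y)).+1 => //.
by rewrite ballE truncnS_gt.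
Qed.

End Balls.

Section Lipschitz.
Context {R : realType} {X : completeMetricType R}.
Implicit Types (x y : X) (f : X -> R).

(** McShane's formula: the largest extension compatible with the Lipschitz
    bound, inf over s in S of f s + K d(s, x). *)
Lemma lipschitz_extension (S : set X) f (K : R) :
  (forall x y, S x -> S y -> `|f x - f y| <= K * mdist x y) ->
  exists2 F : X -> R, lipschitz_map F & forall x, S x -> F x = f x.
Proof.
move=> fK; have [[s0 Ss0]|S0] := pselect (S !=set0); last first.
  exists (fun=> 0) => [|x Sx]; last by exfalso; apply: S0; exists x.
  by exists 0 => x y; rewrite subrr normr0 mul0r.
(* K may be negative when S has at most one point. *)
pose k := `|K|; have k0 : 0 <= k by exact: normr_ge0.
have fk x y : S x -> S y -> `|f x - f y| <= k * mdist x y.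
  move=> Sx Sy; apply: le_trans (fK _ _ Sx Sy) _.
  by apply: ler_wpM2r; rewrite ?mdist_ge0 ?ler_norm.
pose G x := [set f s + k * mdist s x | s in S].
have G0 x : G x !=set0 by exists (f s0 + k * mdist s0 x); exists s0.
have Glb x t : S t -> lbound (G x) (f t - k * mdist t x).
  move=> St _ [s Ss <-]; have := fk _ _ St Ss; rewrite ler_norml => /andP[_].
  have := ler_wpM2l k0 (metric_triangle t x s); rewrite (metric_sym x s).
  by rewrite mulrDr; lra.
have Ghlb x : has_lbound (G x) by exists (f s0 - k * mdist s0 x); exact: Glb.
exists (fun x => inf (G x)).
  have half x y : inf (G x) <= inf (G y) + k * mdist x y.
    rewrite -lerBlDr; apply: lb_le_inf => // _ [s Ss <-].
    rewrite lerBlDr; apply: le_trans (_ : f s + k * mdist s x <= _).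
      by apply: ge_inf => //; exists s.
    rewrite -addrA lerD2l -mulrDr; apply: ler_wpM2l => //.
    by rewrite (metric_sym x y); exact: metric_triangle.
  exists k => x y; rewrite ler_norml; apply/andP; split.
    by have := half y x; rewrite (metric_sym y x); lra.
  by have := half x y; lra.
move=> x Sx; apply/eqP; rewrite eq_le; apply/andP; split.
  by apply: ge_inf => //; exists x; rewrite // mdistxx mulr0 addr0.
apply: lb_le_inf => // ; have := Glb x x Sx.
by rewrite mdistxx mulr0 subr0.
Qed.

Lemma lipschitz_mdist x : lipschitz_map (mdist x).
Proof.
exists 1 => y z; rewrite mul1r ler_norml; apply/andP; split.
  by have := metric_triangle x y z; lra.
by have := metric_triangle x z y; rewrite (metric_sym z y); lra.
Qed.

Lemma ler_norm_coord n (v : 'rV[R]_n) i : `|v 0 i| <= `|v|.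
Proof.
rewrite [leRHS]/Num.norm/= mx_normrE.
by apply: (@le_bigmax _ _ _ _ (fun ij => `|v ij.1 ij.2|) (0, i)).
Qed.

Lemma lipschitz_dotv n (g : X -> 'rV[R]_n) (L : 'rV[R]_n) : lipschitz_map g ->
  exists2 M : R, 0 <= M & forall x y, `|dotv L (g y - g x)| <= M * mdist x y.
Proof.
move=> [K gK]; exists (\sum_(i < n) `|L 0 i| * `|K|).
  by apply: sumr_ge0 => i _; rewrite mulr_ge0.
move=> x y; apply: le_trans (ler_norm_sum _ _ _) _; rewrite mulr_suml.
apply: ler_sum => i _; rewrite normrM -mulrA; apply: ler_wpM2l => //.
apply: le_trans (ler_norm_coord _ _) _; rewrite metric_sym.
apply: le_trans (gK y x) _; apply: ler_wpM2r; first exact: mdist_ge0.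
exact: ler_norm.
Qed.

Lemma dotvB n (L u v : 'rV[R]_n) : dotv L (u - v) = dotv L u - dotv L v.
Proof.
rewrite /dotv -sumrB; apply: eq_bigr => i _; by rewrite !mxE mulrBr.
Qed.

End Lipschitz.

(** * Null sets of an outer measure *)

Section OuterMeasure.
Context {R : realType} {X : completeMetricType R}.
Variable mu : {outer_measure set X -> \bar R}.
Implicit Types (A B : set X) (P Q : X -> Prop).
Local Open Scope ereal_scope.

Lemma outer_measure_bigcup0 (I : countType) (F : I -> set X) :
  (forall i, mu (F i) = 0) -> mu (\bigcup_i F i) = 0.
Proof.
move=> F0; pose F' n := if unpickle n is Some i then F i else set0.
apply/eqP; rewrite eq_le outer_measure_ge0 andbT.
have sub : \bigcup_i F i `<=` \bigcup_n F' n.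
  by move=> x [i _ Fx]; exists (pickle i) => //; rewrite /F' pickleK.
apply: le_trans (le_outer_measure mu _ _ sub) _.
apply: le_trans (outer_measure_sigma_subadditive mu F') _.
by rewrite eseries0// => n _ _; rewrite /F'; case: unpickle.
Qed.

Lemma outer_measure0_sub A B : A `<=` B -> mu B = 0 -> mu A = 0.
Proof.
move=> AB B0; apply/eqP; rewrite eq_le outer_measure_ge0 andbT -B0.
exact: le_outer_measure.
Qed.

Lemma caratheodory0 A : mu A = 0 -> mu.-caratheodory A.
Proof.
move=> A0; apply: le_caratheodory_measurable => B.
have -> : mu (B `&` A) = 0 by apply: outer_measure0_sub A0; exact: subIsetr.
rewrite add0e; by apply: le_outer_measure; exact: subIsetl.
Qed.

Lemma ae_inP A P : ae_in mu A P <-> mu (A `&` [set x | ~ P x]) = 0.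
Proof.
split=> [[N [_ N0 AN]]|A0].
  apply: outer_measure0_sub N0 => x [Ax nPx]; apply: AN => /= h.
  exact/nPx/h.
exists (A `&` [set x | ~ P x]); split => //; first exact: caratheodory0.
by move=> x /= /not_implyP.
Qed.

Lemma ae_in_imp A P Q (Z : set X) : mu Z = 0 ->
  (forall x, A x -> ~ Z x -> P x -> Q x) -> ae_in mu A P -> ae_in mu A Q.
Proof.
move=> Z0 PQ /ae_inP AP; apply/ae_inP/eqP.
rewrite eq_le outer_measure_ge0 andbT.
apply: (@le_trans _ _ (mu (A `&` [set x | ~ P x] `|` Z))).
  apply: le_outer_measure => x [Ax /= nQ]; apply: contrapT => /not_orP[nAP nZ].
  by apply: nQ; apply: PQ => //; apply: contrapT => nP; apply: nAP.
by apply: le_trans (outer_measureU2 _ _ _) _; rewrite AP Z0 adde0.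
Qed.

End OuterMeasure.

(** * Doubling measures and densities *)

Section Doubling.
Context {R : realType} {X : completeMetricType R}.
Variable mu : {outer_measure set X -> \bar R}.
Hypothesis Xmu : metric_measure_space mu.
Variable C : R.
Hypothesis C_gt0 : 0 < C.
Hypothesis doublingC : forall (x : X) (r : R), 0 < r ->
  (mu (ball x (2 * r)) <= C%:E * mu (ball x r))%E.
Implicit Types (x y : X) (r s : R) (A B : set X).
Local Open Scope ereal_scope.

Lemma open_caratheodory A : open A -> mu.-caratheodory A.
Proof. by move=> oA; apply: (mms_borel Xmu); exact: sub_gen_smallest. Qed.

Lemma ball_caratheodory x r : mu.-caratheodory (ball x r).
Proof. exact/open_caratheodory/open_ball. Qed.

(** Stated for powers of two, so that balls of radius 4 r are compared with the
    constant C ^+ 2 and balls of any size with some power of C. *)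
Lemma doubling_iter x r n : (0 < r)%R ->
  mu (ball x (2 ^+ n * r)%R) <= (C ^+ n)%:E * mu (ball x r).
Proof.
move=> r0; elim: n => [|n IH]; first by rewrite !expr0 mul1r mul1e.
rewrite !exprS -mulrA; apply: le_trans (doublingC _ _) _.
  by rewrite mulr_gt0// exprn_gt0.
by rewrite EFinM -muleA; apply: lee_wpmul2l => //; rewrite lee_fin ltW.
Qed.

Lemma exists_expr2_gt (r s : R) : (0 < r)%R -> exists n, (s <= 2 ^+ n * r)%R.
Proof.
move=> r0; exists (Num.truncn (s / r)).+1.
rewrite -ler_pdivrMr//; apply/ltW/(lt_le_trans (truncnS_gt _)).
by rewrite -natrX ler_nat ltnW// ltn_expl.
Qed.

(** Some small ball around x has finite measure; doubling spreads this. *)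
Lemma mu_ball_lty x r : mu (ball x r) < +oo.
Proof.
have [s s0 xs] := mms_locally_finite Xmu x.
have [n rn] := exists_expr2_gt r s0.
apply: (@le_lt_trans _ _ (mu (ball x (2 ^+ n * s)%R))).
  by apply: le_outer_measure; exact: le_ball.
apply: le_lt_trans (doubling_iter x n s0) _.
by rewrite lte_mul_pinfty// lee_fin exprn_ge0// ltW.
Qed.

(** If one ball around x were null, doubling would make all larger ones, hence
    the whole space, null. *)
Lemma mu_ball_gt0 x r : (0 < r)%R -> 0 < mu (ball x r).
Proof.
move=> r0; rewrite lt0e outer_measure_ge0 andbT; apply/eqP => xr0.
have := mms_nontrivial Xmu.
rewrite -(bigcup_ball x) (@outer_measure_bigcup0 _ _ _ nat) ?ltxx// => n.
have [m nm] := exists_expr2_gt n%:R r0.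
apply: (@outer_measure0_sub _ _ _ _ (ball x (2 ^+ m * r)%R)).
  exact: le_ball.
apply/eqP; rewrite eq_le outer_measure_ge0 andbT.
by apply: le_trans (doubling_iter x m r0) _; rewrite xr0 mule0.
Qed.

Lemma sub_ball_fin_num x r A : A `<=` ball x r -> mu A \is a fin_num.
Proof.
move=> Axr; rewrite ge0_fin_numE ?outer_measure_ge0//.
by apply: le_lt_trans (mu_ball_lty x r); exact: le_outer_measure.
Qed.

(** Balls have positive finite measure, so the quotient defining the density is
    an honest real quotient, whose denominator can be cleared. *)
Lemma has_density_fineP A x (t : R) : has_density mu A x t%:E <->
  forall e : R, (0 < e)%R -> \forall r \near 0^'+,
    (`|t * fine (mu (ball x r)) - fine (mu (ball x r `&` A))|
      <= e * fine (mu (ball x r)))%R.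
Proof.
have b_gt0 r : (0 < r)%R -> (0 < fine (mu (ball x r)))%R.
  by move=> r0; rewrite fine_gt0// mu_ball_gt0//= mu_ball_lty.
have qE r : (0 < r)%R -> mu (ball x r `&` A) / mu (ball x r) =
    (fine (mu (ball x r `&` A)) / fine (mu (ball x r)))%:E.
  move=> r0.
  rewrite -[in LHS](@fineK _ (mu (ball x r)))// ?(@sub_ball_fin_num x r)//.
  rewrite -[in LHS](@fineK _ (mu (ball x r `&` A))) ?(@sub_ball_fin_num x r)//.
  by rewrite inver gt_eqF ?b_gt0.
have dE r : (0 < r)%R -> forall e : R,
   (`|t - fine (mu (ball x r `&` A)) / fine (mu (ball x r))| <= e)%R =
   (`|t * fine (mu (ball x r)) - fine (mu (ball x r `&` A))|
      <= e * fine (mu (ball x r)))%R.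
  move=> r0 e; rewrite -ler_pdivrMr ?b_gt0//.
  rewrite -[X in _ = (_ / X <= _)%R](@gtr0_norm _ (fine (mu (ball x r)))) ?b_gt0//.
  by rewrite -normf_div mulrBl mulfK// gt_eqF// b_gt0.
rewrite /has_density; split.
  move=> /fine_cvgP[_ /cvgrPdist_le h] e e0.
  have := h e e0; apply: filterS2 (nbhs_right_gt (0:R)) => r r0 /=.
  by rewrite qE//= dE.
move=> h; apply/fine_cvgP; split.
  by near=> r; rewrite qE.
apply/cvgrPdist_le => e e0.
have := h e e0; apply: filterS2 (nbhs_right_gt (0:R)) => r r0 /=.
by rewrite qE//= dE.
Unshelve. all: by end_near. Qed.

Lemma density_pointP A x : density_point mu A x <->
  forall e : R, (0 < e)%R -> \forall r \near 0^'+,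
    mu (ball x r) <= mu (ball x r `&` A) + e%:E * mu (ball x r).
Proof.
rewrite /density_point has_density_fineP.
suff E r e : (`|1 * fine (mu (ball x r)) - fine (mu (ball x r `&` A))|
      <= e * fine (mu (ball x r)))%R = 
   (mu (ball x r) <= mu (ball x r `&` A) + e%:E * mu (ball x r)).
  by split=> h e e0; have := h e e0; apply: filterS => r; rewrite E.
have bf : mu (ball x r) \is a fin_num by exact: (@sub_ball_fin_num x r).
have af : mu (ball x r `&` A) \is a fin_num by exact: (@sub_ball_fin_num x r).
have ab : mu (ball x r `&` A) <= mu (ball x r) by exact: le_outer_measure.
rewrite mul1r ger0_norm ?subr_ge0 ?fine_le//.
by rewrite -lee_fin EFinB EFinM !fineK// leeBlDl.
Qed.

Lemma density_zeroP A x : density_zero mu A x <->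
  forall e : R, (0 < e)%R -> \forall r \near 0^'+,
    mu (ball x r `&` A) <= e%:E * mu (ball x r).
Proof.
rewrite /density_zero has_density_fineP.
suff E r e : (`|0 * fine (mu (ball x r)) - fine (mu (ball x r `&` A))|
      <= e * fine (mu (ball x r)))%R = 
   (mu (ball x r `&` A) <= e%:E * mu (ball x r)).
  by split=> h e e0; have := h e e0; apply: filterS => r; rewrite E.
have bf : mu (ball x r) \is a fin_num by exact: (@sub_ball_fin_num x r).
have af : mu (ball x r `&` A) \is a fin_num by exact: (@sub_ball_fin_num x r).
rewrite mul0r sub0r normrN ger0_norm ?fine_ge0 ?outer_measure_ge0//.
by rewrite -lee_fin EFinM !fineK.
Qed.

(** * The Lebesgue density theorem *)

Lemma bigcup_cvg (F : (set X)^nat) : (forall n, mu.-caratheodory (F n)) ->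
  (forall n, F n `<=` F n.+1) -> mu (F n) @[n --> \oo] --> mu (\bigcup_n F n).
Proof.
move=> mF ndF.
apply: (@nondecreasing_cvg_mu _ (caratheodory_type mu) R
  (mu : set (caratheodory_type mu) -> \bar R)) => //.
  exact: caratheodory_measurable_bigcup.
by apply/nondecreasing_seqP => n; exact/subsetPset.
Qed.

Lemma bigcap_small (F : (set X)^nat) (e : \bar R) :
  (forall n, mu.-caratheodory (F n)) -> (forall n, F n.+1 `<=` F n) ->
  mu (F 0%N) < +oo -> mu (\bigcap_n F n) < e -> exists n, mu (F n) < e.
Proof.
move=> mF niF F0 Fe.
have niF' : {homo F : n m / (n <= m)%N >-> (m <= n)%O}.
  by apply/nonincreasing_seqP => n; exact/subsetPset.
have mcap : mu.-cara.-measurable (\bigcap_n F n).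
  by apply: bigcapT_measurable => n; exact: mF.
have := @nonincreasing_cvg_mu _ (caratheodory_type mu) R
  (mu : set (caratheodory_type mu) -> \bar R) F F0 mF mcap niF'.
apply: contraPP => /forallNP h /cvge_to_ge - /(_ e); rewrite leNgt Fe => H.
apply: notF; apply: H; apply: nearW => n /=; rewrite leNgt; exact/negP/h.
Qed.

Lemma exists_max_radius (s : seq (X * R)) : s != [::] ->
  exists2 p, p \in s & forall q, q \in s -> (q.2 <= p.2)%R.
Proof.
elim: s => // p s IH _; have [->|/IH[p' p's p'max]] := eqVneq s [::].
  by exists p => [|q]; rewrite mem_seq1 // => /eqP ->.
have [pp'|p'p] := leP p.2 p'.2.
- by exists p' => [|q]; rewrite inE ?p's ?orbT// => /predU1P[->//|/p'max].
- exists p => [|q]; rewrite inE ?eqxx// => /predU1P[->//|/p'max qp'].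
  exact: le_trans qp' (ltW p'p).
Qed.

(** Vitali's covering argument by induction: take a ball B of largest radius,
    and set aside the balls that meet B.  They lie in the concentric ball of
    radius 4 times that of B, whose measure is controlled by mu (B & V).  The
    remaining balls are disjoint from B, so their share of V is also a share of
    V \ B, to which the induction hypothesis applies; the two shares add up to
    mu V because B is measurable. *)
Lemma covering_bound_finite (K : R) (s : seq (X * R)) (V : set X) : (0 <= K)%R ->
  (forall p, p \in s -> (0 < p.2)%R /\
     mu (ball p.1 p.2) <= K%:E * mu (ball p.1 p.2 `&` V)) ->
  mu (\bigcup_(p in [set` s]) ball p.1 p.2) <= (C ^+ 2 * K)%:E * mu V.
Proof.
move=> K0; have C20 : (0 <= C ^+ 2)%R by rewrite exprn_ge0// ltW.
elim: {s}(size s).+1 {-2}s (ltnSn (size s)) V => // n IH s sn V sV.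
have [->|/exists_max_radius[p ps pmax]] := eqVneq s [::].
  rewrite (_ : [set` [::]] = set0) ?bigcup_set0 ?outer_measure0.
    by rewrite mule_ge0 ?outer_measure_ge0// lee_fin mulr_ge0.
  by apply/seteqP; split.
have [p0 pV] := sV _ ps.
pose B := ball p.1 p.2.
pose disjB q := `[< ball q.1 q.2 `&` B = set0 >].
pose s' := [seq q <- s | disjB q].
have s'n : (size s' < n)%N.
  rewrite -ltnS; apply: leq_trans sn; rewrite ltnS size_filter.
  rewrite ltn_neqAle count_size andbT -all_count.
  apply/allPn; exists p => //; apply/asboolP => /seteqP[+ _] => /(_ p.1).
  by apply; split; exact: ballxx.
have covs : \bigcup_(q in [set` s]) ball q.1 q.2 `<=`
    ball p.1 (2 ^+ 2 * p.2) `|` \bigcup_(q in [set` s']) ball q.1 q.2.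
  move=> x [q /= qs qx]; have [dq|/asboolPn/eqP/set0P[z [qz pz]]] := boolP (disjB q).
    by right; exists q => //=; rewrite mem_filter dq.
  left; have := pmax _ qs; move: qz pz qx; rewrite /B !ballE metric_sym.
  have := metric_triangle p.1 z x; have := metric_triangle z q.1 x.
  by lra.
apply: le_trans (le_outer_measure mu _ _ covs) _.
apply: le_trans (outer_measureU2 _ _ _) _.
have mB : mu.-caratheodory B by exact: ball_caratheodory.
rewrite (mB V) ge0_muleDr ?outer_measure_ge0//; apply: leeD.
  apply: le_trans (doubling_iter _ _ p0) _; rewrite (EFinM (C ^+ 2)) -muleA.
  by apply: lee_wpmul2l; rewrite ?lee_fin// setIC.
apply: IH => // q; rewrite mem_filter => /andP[/asboolP dq /sV[q0 qV]].
split=> //; rewrite (_ : _ `&` _ = ball q.1 q.2 `&` V)//.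
apply/seteqP; split=> x [qx]; first by case.
move=> Vx; split=> //; split=> // Bx; suff : set0 x by [].
by rewrite -dq.
Qed.

(** A countable family is an increasing union of finite ones, and these satisfy
    the bound with the same constant. *)
Lemma covering_bound (K : R) (I : set (X * R)) (V : set X) : (0 <= K)%R ->
  countable I ->
  (forall p, I p -> (0 < p.2)%R /\
     mu (ball p.1 p.2) <= K%:E * mu (ball p.1 p.2 `&` V)) ->
  mu (\bigcup_(p in I) ball p.1 p.2) <= (C ^+ 2 * K)%:E * mu V.
Proof.
move=> K0 /pcard_surjP[u uI] IV.
pose s n := [seq p <- map u (iota 0 n) | `[< I p >]].
have sS n p : p \in s n -> p \in s n.+1.
  rewrite !mem_filter => /andP[-> /mapP[i + ->]]; rewrite mem_iota => /andP[_].
  rewrite add0n => i_n; apply/mapP; exists i; rewrite // mem_iota add0n/=.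
  exact: ltnW.
pose F n := \bigcup_(p in [set` s n]) ball p.1 p.2.
have mF n : mu.-caratheodory (F n).
  by apply: open_caratheodory; apply: bigcup_open => p _; exact: open_ball.
have ndF n : F n `<=` F n.+1.
  by move=> x [p /= /sS ps px]; exists p.
have -> : \bigcup_(p in I) ball p.1 p.2 = \bigcup_n F n.
  apply/seteqP; split=> x.
    move=> [p Ip px]; have [n _ unp] := uI _ Ip.
    exists n.+1 => //; exists p => //=; rewrite mem_filter asboolT// andTb.
    by apply/mapP; exists n; rewrite // mem_iota add0n/=.
  move=> [n _ [p /=]]; rewrite mem_filter => /andP[/asboolP Ip _] px.
  by exists p.
apply: (cvge_to_le (bigcup_cvg mF ndF)); apply: nearW => n.
apply: covering_bound_finite => // p; rewrite mem_filter => /andP[/asboolP Ip _].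
exact: IV.
Qed.

(** Two-sided outer approximation inside B0 by open sets; it is symmetric in A
    and its complement, which makes closure under complements immediate. *)
Definition approximable (B0 A : set X) : Prop := forall e : R, (0 < e)%R ->
  exists U W : set X, [/\ open U, open W, A `<=` U, ~` A `<=` W &
    mu (U `&` W `&` B0) < e%:E].

(** The approximable sets form a sigma-algebra containing the open sets.  In a
    countable union only finitely many of the open sets around the complements
    can be intersected if the result is to stay open; continuity from above on
    the finite measure of B0 shows that finitely many suffice. *)
Lemma approximable_borel x0 r0 A : <<s open >> A -> approximable (ball x0 r0) A.
Proof.
set B0 := ball x0 r0.
have B0fin (A' : set X) : A' `<=` B0 -> mu A' < +oo.
  move=> A'B; apply: le_lt_trans (mu_ball_lty x0 r0).
  exact: le_outer_measure.
have mB0 : mu.-caratheodory B0 by exact: ball_caratheodory.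
apply: smallest_sub; first split.
- move=> e e0; exists set0, setT; split=> //; [exact: open0|exact: openT|].
  by rewrite !set0I outer_measure0 lte_fin.
- move=> B hB e /hB[U [W [Uop Wop BU BW UW]]]; exists W, U; split=> //.
  + by rewrite setTD.
  + by rewrite setTD setCK.
  + by rewrite (setIC W).
- move=> F hF e e0.
  have /choice[U /choice[W UW]] : forall n, exists U W, [/\ open U, open W, F n `<=` U,
      ~` F n `<=` W & mu (U `&` W `&` B0) < (e / 2 / (2 ^ n.+1)%:R)%:E].
    by move=> n; apply: hF; rewrite !divr_gt0// ltr0n expn_gt0.
  pose U' := \bigcup_n U n; pose W' n := \bigcap_(i < n) W i.
  have Uop' : open U' by apply: bigcup_open => n _; case: (UW n).
  have Wop' n : open (W' n).
    rewrite /W' bigcap_mkord; elim/big_ind : _; [exact: openT|exact: openI|].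
    by move=> i _; case: (UW i).
  have [n ne] : exists n, mu (U' `&` W' n `&` B0) < e%:E.
    apply: bigcap_small.
    + move=> n; apply: caratheodory_measurable_setI => //.
      by apply: open_caratheodory; exact: openI.
    + move=> n x [[U'x Ox] B0x]; split=> //; split=> // i /= i_n.
      by apply: Ox; rewrite /= ltnS ltnW.
    + by apply: B0fin; exact: subIsetr.
    + apply: (@le_lt_trans _ _ (e / 2)%:E); last first.
        by rewrite lte_fin ltr_pdivrMr// ltr_pMr// ltr1n.
      have sub : \bigcap_n (U' `&` W' n `&` B0) `<=`
          \bigcup_n (U n `&` W n `&` B0).
        move=> x h; have [[[n _ Unx] _] B0x] := h 0%N I.
        exists n => //; split=> //; split=> //.
        by have [[_ Ox] _] := h n.+1 I; apply: Ox => /=.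
      apply: le_trans (le_outer_measure mu _ _ sub) _.
      apply: le_trans (outer_measure_sigma_subadditive mu _) _.
      apply: le_trans (epsilon_trick0 xpredT _); last by rewrite divr_ge0// ltW.
      apply: lee_nneseries => [i _ _|i _]; first exact: outer_measure_ge0.
      by case: (UW i) => _ _ _ _ /ltW.
  exists U', (W' n); split=> //.
  + by move=> x [i _ Fx]; exists i => //; case: (UW i) => _ _ + _ _; exact.
  + move=> x nFx i _; case: (UW i) => _ _ _ + _; apply=> Fx.
    by apply: nFx; exists i.
- move=> U Uop e e0.
  (* The open neighbourhoods of the complement of U shrink to it. *)
  pose W n := [set y | exists2 z, ~ U z & ball z (n.+1%:R^-1) y].
  have Wop n : open (W n).
    have -> : W n = \bigcup_(z in ~` U) ball z (n.+1%:R^-1) by [].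
    by apply: bigcup_open => z _; exact: open_ball.
  have [n ne] : exists n, mu (U `&` W n `&` B0) < e%:E.
    apply: bigcap_small.
    + move=> n; apply: caratheodory_measurable_setI => //.
      by apply: open_caratheodory; exact: openI.
    + move=> n x [[Ux [z nUz zx]] B0x]; split=> //; split=> //; exists z => //.
      by apply: le_ball zx; rewrite lef_pV2 ?posrE// ler_nat.
    + by apply: B0fin; exact: subIsetr.
    + rewrite (_ : \bigcap_n _ = set0) ?outer_measure0 ?lte_fin//.
      apply/seteqP; split=> // x h.
      have [[Ux _] _] := h 0%N I.
      have /nbhs_ballP[d /= d0 xd] : nbhs x U by exact: open_nbhs_nbhs.
      have [[_ [z nUz zx]] _] := h (Num.truncn d^-1) I.
      apply: nUz; apply: xd; apply: ball_sym; apply: le_ball zx.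
      by rewrite invf_ple ?posrE// ltW// truncnS_gt.
  exists U, (W n); split=> // x nUx; exists x => //; exact: ballxx.
Qed.

Lemma outer_regularity A x0 (r0 e : R) : <<s open >> A -> (0 < e)%R ->
  exists U, [/\ open U, A `<=` U & mu (U `&` ~` A `&` ball x0 r0) < e%:E].
Proof.
move=> /(approximable_borel x0 r0) hA /hA[U [W [Uop _ AU AW e_]]].
exists U; split=> //; apply: le_lt_trans e_; apply: le_outer_measure.
by apply: setSI; exact: setIS.
Qed.

(** The two parts of A cut out by M have at most the measure of the
    corresponding parts of H, while the totals agree and are finite. *)
Lemma hullI A H M : A `<=` H -> mu A = mu H -> mu H < +oo ->
  mu.-caratheodory M -> mu (M `&` A) = mu (M `&` H).
Proof.
move=> AH AH_ Hoo mM; apply/eqP; rewrite eq_le; apply/andP; split.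
  by apply: le_outer_measure; exact: setIS.
rewrite leNgt; apply/negP => lt_.
have : mu A < mu H.
  rewrite (mM A) (mM H) (setIC A M) (setIC H M); apply: lte_leD => //.
    rewrite ge0_fin_numE ?outer_measure_ge0//; apply: le_lt_trans Hoo.
    by rewrite -AH_; apply: le_outer_measure; exact: subIsetl.
  by apply: le_outer_measure; exact: setSI.
by rewrite AH_ ltxx.
Qed.

(** For e > 0, the points of A around which A misses more than the proportion e
    of arbitrarily small balls form a null set: such balls carry at least the
    proportion e of their mass in V = U \ H, where H is the Borel hull of A and U
    is an open set around H with mu V as small as wished, so [covering_bound]
    applies. *)
Lemma density_theorem_bounded A x0 (r0 : R) : A `<=` ball x0 r0 ->
  ae_in mu A (density_point mu A).
Proof.
move=> AB0.
pose good e x := \forall r \near 0^'+,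
  mu (ball x r) <= mu (ball x r `&` A) + e%:E * mu (ball x r).
apply/ae_inP.
suff bad0 n : mu (A `&` [set x | ~ good (n.+1%:R^-1)%R x]) = 0.
  apply: outer_measure0_sub (@outer_measure_bigcup0 _ _ _ nat _ bad0) => x [Ax].
  apply: contra_notP => /= nbad; apply/density_pointP => e e0.
  have [n ne] : exists n, (n.+1%:R^-1 <= e)%R.
    by exists (Num.truncn e^-1); rewrite invf_ple ?posrE// ltW// truncnS_gt.
  have : good (n.+1%:R^-1)%R x.
    by apply: contra_notP nbad => ngx; exists n.
  apply: filterS => r /le_trans; apply; apply: leeD => //.
  by apply: lee_wpmul2r; rewrite ?outer_measure_ge0 ?lee_fin.
set e := (n.+1%:R^-1)%R; have e0 : (0 < e)%R by rewrite invr_gt0.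
have [H [bH AH AHmu]] := mms_regular Xmu A.
have [D cD dD] := mms_separable Xmu.
(* Replacing a ball by one with centre in D and rational radius costs the
   factor C ^+ 2. *)
pose K := (C ^+ 2 / e)%R.
have K0 : (0 <= K)%R by rewrite divr_ge0 ?exprn_ge0// ltW.
apply/eqP; rewrite eq_le outer_measure_ge0 andbT; apply/lee_addgt0Pr => t t0.
rewrite add0e.
have CK0 : (0 < C ^+ 2 * K)%R by rewrite !mulr_gt0 ?invr_gt0 ?exprn_gt0.
have [U [Uop HU Ut]] := outer_regularity x0 r0 bH (divr_gt0 t0 CK0).
pose W := U `&` ball x0 r0; pose V := U `&` ~` H `&` ball x0 r0.
have oW : open W by apply: openI => //; exact: open_ball.
pose I := [set p | [/\ D p.1, range (ratr : rat -> R) p.2, (0 < p.2)%R &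
     mu (ball p.1 p.2) <= K%:E * mu (ball p.1 p.2 `&` V)]].
have cI : countable I.
  apply: (@sub_countable _ _ _ (D `*` range (ratr : rat -> R))).
    by apply: subset_card_le => p [].
  apply: countableX => //; exact: sub_countable (card_image_le _ _) (countableP _).
have badI : A `&` [set x | ~ good e x] `<=` \bigcup_(p in I) ball p.1 p.2.
  move=> x [Ax ngood].
  have Wx : W x by split; [exact/HU/AH|exact: AB0].
  have /nbhs_ballP[d /= d0 xdW] : nbhs x W by exact: open_nbhs_nbhs.
  have [r [r0' rd rbad]] : exists r, [/\ 0 < r, 4 * r <= d &
      ~ (mu (ball x r) <= mu (ball x r `&` A) + e%:E * mu (ball x r))%E]%R.
    apply: contra_notP ngood => h; near=> r.
    apply: contra_notP h => rbad; exists r; split=> //.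
    rewrite mulrC -ler_pdivlMr//; near: r; apply: nbhs_right_le.
    by rewrite divr_gt0.
  set b := ball x r in rbad.
  have bW : b `<=` W.
    by apply: subset_trans xdW; apply: le_ball; lra.
  have bfin (B : set X) : mu (b `&` B) \is a fin_num.
    by apply: (@sub_ball_fin_num x r); exact: subIsetl.
  have mb : e%:E * mu b <= mu (b `&` V).
    have -> : b `&` V = b `&` ~` H.
      apply/seteqP; split=> y [by_ Vy]; split=> //; first by case: Vy => -[].
      by have [] := bW _ by_.
    move/negP: rbad; rewrite -ltNge [X in _ < X](mms_borel Xmu bH b).
    rewrite (hullI AH AHmu); last exact: ball_caratheodory.
      by rewrite lteD2lE// => /ltW.
    rewrite -AHmu; apply: le_lt_trans (mu_ball_lty x0 r0).
    exact: le_outer_measure.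
  have [y [xy Dy]] : ball x r `&` D !=set0.
    by apply: dD; [exists x; exact: ballxx|exact: open_ball].
  (* Radius at least 2 r ensures that the ball around y contains b; radius at
     most 3 r keeps it inside the ball of radius 4 r around x. *)
  have [q] : exists q : rat, ratr q \in `]2 * r, 3 * r[%R.
    by apply: rat_in_itvoo; lra.
  rewrite in_itv/= => /andP[rq qr].
  have q0 : (0 < ratr q :> R)%R by lra.
  move: xy; rewrite ballE => xy.
  have bq : b `<=` ball y (ratr q).
    by apply: subset_ball; rewrite metric_sym; lra.
  have q4 : ball y (ratr q) `<=` ball x (2 ^+ 2 * r)%R.
    by apply: subset_ball; lra.
  exists (y, ratr q); last by apply: bq; exact: ballxx.
  split=> //=; first by exists q.
  apply: le_trans (le_outer_measure mu _ _ q4) _.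
  apply: le_trans (doubling_iter _ _ r0') _.
  rewrite /K (EFinM (C ^+ 2)%R) -muleA; apply: lee_wpmul2l.
    by rewrite lee_fin exprn_ge0// ltW.
  apply: (@le_trans _ _ (e^-1%:E * mu (b `&` V))); last first.
    apply: lee_wpmul2l; first by rewrite lee_fin invr_ge0 ltW.
    by apply: le_outer_measure; exact: setSI.
  by rewrite lee_pdivlMl.
apply: le_trans (le_outer_measure mu _ _ badI) _.
apply: le_trans (covering_bound (K := K) (V := V) K0 cI _) _.
  by move=> p [].
by rewrite -lee_pdivlMl// -EFinM mulrC; exact: ltW.
Unshelve. all: by end_near. Qed.

(** A need not be measurable: it is its outer measure in balls that is compared
    with the measure of the balls. *)
Lemma density_theorem A : ae_in mu A (density_point mu A).
Proof.
pose F n := A `&` ball (point : X) n%:R.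
apply/ae_inP; have -> : A = \bigcup_n F n by rewrite /F -setI_bigcupr bigcup_ball setIT.
rewrite setI_bigcupl; apply: outer_measure_bigcup0 => n.
have /ae_inP := @density_theorem_bounded (F n) _ _ (@subIsetr _ _ _).
apply: outer_measure0_sub => x [Fx nx]; split=> //=.
apply: contra_not nx => /density_pointP Fd; apply/density_pointP => e /Fd.
apply: filterS => r /le_trans; apply; apply: leeD => //.
by apply: le_outer_measure; apply: setIS; exact: bigcup_sup.
Qed.
Lemma density_pointS A B x : A `<=` B -> density_point mu A x -> density_point mu B x.
Proof.
move=> AB /density_pointP Ax; apply/density_pointP => e /Ax.
apply: filterS => r /le_trans; apply; apply: leeD => //.
by apply: le_outer_measure; exact: setIS.
Qed.

Lemma density_zeroS A B x : A `<=` B -> density_zero mu B x -> density_zero mu A x.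
Proof.
move=> AB /density_zeroP Bx; apply/density_zeroP => e /Bx.
by apply: filterS => r; apply: le_trans; apply: le_outer_measure; exact: setIS.
Qed.

(** Measurability of A is what makes the measures of the two parts of a ball
    add up. *)
Lemma density_zeroC A x : mu.-caratheodory A ->
  density_point mu A x -> density_zero mu (~` A) x.
Proof.
move=> mA /density_pointP Ax; apply/density_zeroP => e /Ax.
apply: filterS => r; rewrite [X in X <= _](mA (ball x r)) leeD2lE//.
by apply: (@sub_ball_fin_num x r); exact: subIsetl.
Qed.

(** Only one of the two sets has to be measurable: a ball loses from A at most
    what lies outside B. *)
Lemma density_pointI A B x : mu.-caratheodory B ->
  density_point mu A x -> density_point mu B x -> density_point mu (A `&` B) x.
Proof.
move=> mB /density_pointP Ax /(density_zeroC mB) /density_zeroP Bx.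
apply/density_pointP => e e0; have e20 : (0 < e / 2)%R by rewrite divr_gt0.
apply: filterS2 (Ax _ e20) (Bx _ e20) => r /le_trans hA hB; apply: hA.
rewrite [X in X + _](mB (ball x r `&` A)) -setIA -addeA; apply: leeD => //.
apply: (@le_trans _ _ ((e / 2)%:E * mu (ball x r) + (e / 2)%:E * mu (ball x r))).
  apply: leeD => //; apply: le_trans hB; apply: le_outer_measure.
  by apply: setSI; exact: subIsetl.
rewrite -ge0_muleDl ?lee_fin ?(ltW e20)// -EFinD.
by rewrite (_ : (e / 2 + e / 2)%R = e)//; lra.
Qed.

(** * Stepanov's decomposition into Lipschitz pieces *)

Lemma ap_limsup_lty (F : X -> R) x : ap_limsup mu F x < +oo <->
  exists n : nat, density_zero mu [set y | (n%:R < F y)%R] x.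
Proof.
split=> [/ereal_inf_lt[_ [a /= Fa <-] _]|[n Fn]].
  exists (Num.truncn a).+1; apply: density_zeroS Fa => y /=.
  by apply: lt_trans; exact: truncnS_gt.
apply: (@le_lt_trans _ _ n%:R%:E); last exact: ltry.
by apply: ereal_inf_lbound; exists n%:R%R.
Qed.

(** A piece is indexed by a slope k, a scale j below which the points z with
    |f z - f x| > k d(x, z) occupy at most the proportion c of the balls around
    x, and an element of a dense sequence used to cut the piece down to a
    diameter comparable with that scale. *)
Lemma stepanov_decomposition (f : X -> R) :
  exists F : nat * nat * nat -> set X,
    [set x | ap_limsup mu (diff_quotient f x) x < +oo] `<=` \bigcup_t F t /\
    forall t, exists K : R, forall x y, F t x -> F t y ->
      (`|f x - f y| <= K * mdist x y)%R.
Proof.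
have [D /pcard_surjP[u uD] dD] := mms_separable Xmu.
pose steep (k : nat) x := [set y | (k%:R < diff_quotient f x y)%R].
(* For points x and y at distance r, the two bad sets have measure at most
   c mu (ball x r) and c mu (ball y (2 r)) <= c C ^+ 2 mu (ball x r).  With
   this c, their sum is half of mu (ball x r). *)
pose c : R := ((2 * (1 + C ^+ 2))^-1)%R.
have C20 : (0 <= C ^+ 2)%R by rewrite exprn_ge0// ltW.
have c0 : (0 < c)%R by rewrite invr_gt0; lra.
pose G (k j : nat) := [set x | forall r, (0 < r)%R -> (r <= j.+1%:R^-1)%R ->
  mu (ball x r `&` steep k x) <= c%:E * mu (ball x r)].
(* Points in a common ball of radius d j are closer than half the scale, so
   that balls of radius 2 d(x, y) around them are below it. *)
pose d (j : nat) : R := (j.+1%:R^-1 / 4)%R.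
have d0 j : (0 < d j)%R by rewrite divr_gt0 ?invr_gt0.
exists (fun t => G t.1.1 t.1.2 `&` ball (u t.2) (d t.1.2)); split.
  move=> x /= /ap_limsup_lty[k /density_zeroP/(_ c c0)[e /= e0 xe]].
  pose j := Num.truncn e^-1.
  have je : (j.+1%:R^-1 < e)%R by rewrite invf_plt ?posrE// truncnS_gt.
  have [y [xy Dy]] : ball x (d j) `&` D !=set0.
    apply: dD; [by exists x; exact: ballxx|exact: open_ball].
  have [i _ ui] := uD _ Dy.
  exists (k, j, i) => //; split; last by rewrite /= ui; exact: ball_sym.
  move=> r r0 rj; apply: xe => //=; rewrite /ball/= sub0r normrN gtr0_norm//.
  exact: le_lt_trans je.
move=> [[k j] i]; exists (3 * k%:R)%R => x y [/= Gx ux] [/= Gy uy].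
have [->|xy] := eqVneq x y; first by rewrite subrr normr0 mdistxx mulr0.
have steepN x' z : ~ steep k x' z -> (`|f z - f x'| <= k%:R * mdist x' z)%R.
  move=> /negP; rewrite -leNgt /diff_quotient.
  have [->|x'z] := eqVneq x' z; first by rewrite subrr normr0 mdistxx mulr0.
  by rewrite ler_pdivrMr// mdist_gt0.
pose r := mdist x y; have r0 : (0 < r)%R by rewrite mdist_gt0.
have r2 : (2 * r <= j.+1%:R^-1)%R.
  move: ux uy; rewrite !ballE /d => ux uy.
  have := metric_triangle x (u i) y; rewrite (metric_sym x (u i)) -/r.
  by set J := (_^-1)%R in ux uy *; clearbody J; lra.
have [z [xz nxz nyz]] : exists z, [/\ ball x r z, ~ steep k x z & ~ steep k y z].
  apply: contrapT => /forallNP nz.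
  have cov : ball x r `<=` (ball x r `&` steep k x) `|` (ball y (2 * r) `&` steep k y).
    move=> z xz; have [sx|nsx] := pselect (steep k x z); first by left.
    right; split.
      by apply: subset_ball xz; rewrite metric_sym -/r; lra.
    by apply: contrapT => nsy; apply: (nz z).
  have bx : mu (ball x r `&` steep k x) <= c%:E * mu (ball x r).
    by apply: Gx => //; apply: le_trans r2; lra.
  have by_ : mu (ball y (2 * r) `&` steep k y) <= (c * C ^+ 2)%:E * mu (ball x r).
    apply: le_trans (Gy _ _ r2) _; first by lra.
    rewrite (EFinM c) -muleA; apply: lee_wpmul2l; first by rewrite lee_fin ltW.
    apply: le_trans (doubling_iter x 2 r0); apply: le_outer_measure.
    by apply: subset_ball; rewrite -/r; lra.
  have : mu (ball x r) <= (2^-1)%:E * mu (ball x r).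
    apply: le_trans (le_outer_measure mu _ _ cov) _.
    apply: le_trans (outer_measureU2 _ _ _) _.
    apply: le_trans (leeD bx by_) _.
    have cC0 : (0 <= c * C ^+ 2)%R by rewrite mulr_ge0// ltW.
    rewrite -ge0_muleDl ?lee_fin//; last exact: ltW.
    rewrite -EFinD (_ : (c + c * C ^+ 2)%R = 2^-1%R)// /c; field.
    by rewrite gt_eqF//; lra.
  have xfin : mu (ball x r) \is a fin_num by exact: (@sub_ball_fin_num x r).
  have : (0 < fine (mu (ball x r)))%R by rewrite fine_gt0// mu_ball_gt0//= mu_ball_lty.
  rewrite -(fineK xfin) -EFinM lee_fin; lra.
have yz : (mdist y z <= 2 * r)%R.
  move: xz; rewrite ballE => xz.
  by have := metric_triangle y x z; rewrite (metric_sym y x) -/r; lra.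
have hx := steepN _ _ nxz; have hy := steepN _ _ nyz.
move: xz; rewrite ballE -/r => xz.
apply: (@le_trans _ _ (`|f z - f x| + `|f z - f y|)%R).
  by rewrite (distrC (f z) (f x)) (le_trans _ (ler_normD _ _))// addrA subrK.
have k0 : (0 <= k%:R :> R)%R by [].
have : (k%:R * mdist x z <= k%:R * r)%R by apply: ler_wpM2l => //; exact: ltW.
have : (k%:R * mdist y z <= k%:R * (2 * r))%R by apply: ler_wpM2l.
lra.
Qed.

(** * Approximate differentiability *)

Lemma lipschitz_measurable (h : X -> R) :
  lipschitz_map h -> mu_measurable_fun mu setT h.
Proof.
move=> [K hK]; rewrite /mu_measurable_fun; apply: (measurability _ (RGenOInfty.measurableE R)).
move=> _ [_ [a ->] <-]; rewrite setTI; apply: open_caratheodory.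
rewrite openE => x /=; rewrite in_itv/= andbT => ax; apply/nbhs_ballP.
have k0 : (0 < `|K| + 1)%R by rewrite ltr_wpDl.
exists ((h x - a) / (`|K| + 1))%R => /=.
  by rewrite divr_gt0// subr_gt0.
move=> y; rewrite ballE ltr_pdivlMr// => xy; rewrite /= in_itv/= andbT.
have : (h x - h y <= mdist x y * (`|K| + 1))%R.
  apply: le_trans (ler_norm _) _; apply: le_trans (hK x y) _; rewrite mulrC.
  apply: ler_wpM2l; first exact: mdist_ge0.
  by rewrite (le_trans (ler_norm K))// lerDl.
lra.
Qed.

Lemma remainder_measurable n (g : X -> 'rV[R]_n) (f : X -> R) L x (e : R) :
  (0 < e)%R -> lipschitz_map g -> mu_measurable_fun mu setT f ->
  mu.-caratheodory [set y | (remainder_quotient g f L x y < e)%R].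
Proof.
rewrite /mu_measurable_fun => e0 Lg mf; pose h y := `|f y - f x - dotv L (g y - g x)|%R.
have mh : mu_measurable_fun mu setT h.
  rewrite /mu_measurable_fun.
  apply: measurableT_comp; first exact: normr_measurable.
  apply: measurable_funB; first by apply: measurable_funB.
  have [M M0 LM] := lipschitz_dotv L Lg.
  apply: lipschitz_measurable; exists M => y z.
  by rewrite -dotvB opprB addrA subrK metric_sym; exact: LM.
have md : mu_measurable_fun mu setT (mdist x).
  exact/lipschitz_measurable/lipschitz_mdist.
(* At distance zero the quotient vanishes; elsewhere the denominator can be
   cleared. *)
have -> : [set y | (remainder_quotient g f L x y < e)%R] =
    [set y | (h y < e * mdist x y)%R] `|` ~` [set y | (0 < mdist x y)%R].
  apply/seteqP; split=> y /=.
    have [d0|d0] := ltP 0%R (mdist x y); last by right.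
    by rewrite /remainder_quotient ltr_pdivrMr//; left.
  have [d0|xy] := eqVneq (mdist x y) 0%R.
    by move=> _; rewrite /remainder_quotient d0 invr0 mulr0.
  have d0 : (0 < mdist x y)%R by rewrite lt_neqAle eq_sym xy mdist_ge0.
  by case=> //; rewrite /remainder_quotient ltr_pdivrMr.
have ltP (u v : X -> R) : mu_measurable_fun mu setT u -> mu_measurable_fun mu setT v ->
    mu.-cara.-measurable [set y | (u y < v y)%R].
  rewrite /mu_measurable_fun => mu_ mv; have := measurable_fun_ltr mu_ mv.
  move=> /(_ measurableT [set true] I); rewrite setTI.
  by congr (_ _).
apply: (@measurableU _ (caratheodory_type mu)).
  by apply: ltP => //; apply: measurable_funM => //; exact: measurable_cst.
apply: (@measurableC _ (caratheodory_type mu)).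
by apply: ltP => //; exact: measurable_cst.
Qed.

(** Where the remainder quotient is below 1, the difference quotient is at most
    1 + M, with M a Lipschitz constant for the linear part L . (g y - g x). *)
Lemma approx_gradient_ap_limsup n (g : X -> 'rV[R]_n) (f : X -> R) L x :
  lipschitz_map g -> mu_measurable_fun mu setT f ->
  approx_gradient mu g f x L -> ap_limsup mu (diff_quotient f x) x < +oo.
Proof.
move=> Lg mf /(_ 1%R ltr01) fL; apply/ap_limsup_lty.
have [M M0 LM] := lipschitz_dotv L Lg.
exists (Num.truncn (1 + M)).+1.
have mA := @remainder_measurable n g f L x _ ltr01 Lg mf.
rewrite (_ : [set y | _] = [set y | remainder_quotient g f L x y < 1]%R) in fL.
  apply: density_zeroS (density_zeroC mA fL) => y /= My rem1.
  have [xy|xy] := eqVneq (mdist x y) 0%R.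
    by move: My; rewrite /diff_quotient xy invr0 mulr0 ltNge ler0n.
  have d0 : (0 < mdist x y)%R by rewrite lt_neqAle eq_sym xy mdist_ge0.
  move: My; apply/negP; rewrite -leNgt; apply: le_trans (ltW (truncnS_gt _)).
  move: rem1; rewrite /diff_quotient /remainder_quotient ltr_pdivrMr// mul1r.
  rewrite ler_pdivrMr// mulrDl mul1r => rem1.
  rewrite -[X in (`|X| <= _)%R](subrK (dotv L (g y - g x))).
  by apply: le_trans (ler_normD _ _) _; apply: lerD; [exact: ltW|exact: LM].
apply/seteqP; split=> y /=; rewrite subr0 ger0_norm//;
  by rewrite divr_ge0// mdist_ge0.
Qed.

(** On S, and at x itself, f and F coincide, so both remainder quotients agree
    on a set having x as a density point. *)
Lemma approx_gradient_agree n (g : X -> 'rV[R]_n) (f F : X -> R) (S : set X) L x :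
  lipschitz_map g -> lipschitz_map F -> (forall y, S y -> F y = f y) ->
  S x -> density_point mu S x ->
  approx_gradient mu g F x L -> approx_gradient mu g f x L.
Proof.
move=> Lg LF Ff Sx dS FL e e0.
have rem0 (h : X -> R) y : (`|remainder_quotient g h L x y - 0| =
    remainder_quotient g h L x y)%R.
  by rewrite subr0 ger0_norm// divr_ge0// mdist_ge0.
have := FL e e0; under eq_set do rewrite rem0.
have mA := @remainder_measurable n g F L x _ e0 Lg (lipschitz_measurable LF).
move=> /(density_pointI mA dS); apply: density_pointS => y [Sy] /=.
by rewrite rem0 /remainder_quotient !Ff.
Qed.

(** Almost every point of S in the chart is a density point of S at which the
    Lipschitz extension of f has an approximate gradient. *)
Lemma lipschitz_piece_differentiable (Lambda : countType) (N : Lambda -> nat)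
    (U : Lambda -> set X) (g : forall a, X -> 'rV[R]_(N a)) (f : X -> R)
    (S : set X) (K : R) a :
  approx_diff_structure mu U g ->
  (forall x y, S x -> S y -> (`|f x - f y| <= K * mdist x y)%R) ->
  ae_in mu (S `&` U a) (approx_differentiable mu (g a) f).
Proof.
move=> ads /lipschitz_extension[F LF Ff].
have [D [_ _ /ae_inP FD] _] := ads_differential ads LF a.
have /ae_inP dS := density_theorem S.
apply/ae_inP; apply/eqP; rewrite eq_le outer_measure_ge0 andbT.
apply: (@le_trans _ _ (mu ((S `&` [set x | ~ density_point mu S x]) `|`
  (U a `&` [set x | ~ approx_gradient mu (g a) F x (D x)])))).
  apply: le_outer_measure => x [[Sx Ux] /= nf].
  have [dSx|] := pselect (density_point mu S x); last by left.
  right; split=> //=; apply: contra_not nf => FDx; exists (D x).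
  exact: (approx_gradient_agree (ads_lipschitz ads a) LF Ff Sx dSx FDx).
by apply: le_trans (outer_measureU2 _ _ _) _; rewrite dS FD adde0.
Qed.

End Doubling.

Theorem corollary2p4 (R : realType) (X : completeMetricType R)
    (mu : {outer_measure set X -> \bar R})
    (Lambda : countType) (N : Lambda -> nat) (U : Lambda -> set X)
    (g : forall a : Lambda, X -> 'rV[R]_(N a))
    (f : X -> R) (E : set X) :
  metric_measure_space mu ->
  doubling mu ->
  approx_diff_structure mu U g ->
  mu_measurable_fun mu setT f ->
  mu_measurable mu E ->
  (exists (x0 : X) (r : R), E `<=` ball x0 r) ->
  approx_differentiable_ae mu U g f E <->
  ae_in mu E (fun x => (ap_limsup mu (diff_quotient f x) x < +oo)%E).
Proof.
move=> Xmu [C C0 dC] ads mf _ _; rewrite /approx_differentiable_ae; split.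
  move=> fE; apply: (ae_in_imp (ads_cover ads) _ fE).
  move=> x Ex /contrapT[a _ Ua] /(_ _ Ua)[L fL].
  exact: (approx_gradient_ap_limsup Xmu C0 dC (ads_lipschitz ads a) mf fL).
have [F [covF lipF]] := stepanov_decomposition Xmu C0 dC f.
pose bad x := ~ forall a, U a x -> approx_differentiable mu (g a) f x.
have bad0 : mu ([set x | (ap_limsup mu (diff_quotient f x) x < +oo)%E] `&` bad) = 0%E.
  pose G (p : Lambda * (nat * nat * nat)) := F p.2 `&` U p.1 `&`
    [set x | ~ approx_differentiable mu (g p.1) f x].
  have /outer_measure_bigcup0 : forall p, mu (G p) = 0%E.
    move=> [a t]; have [K lipK] := lipF t.
    exact/ae_inP/(lipschitz_piece_differentiable Xmu C0 dC a ads lipK).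
  apply: outer_measure0_sub => x [/covF[t _ Ftx]] /existsNP[a /not_implyP[Uax nd]].
  by exists (a, t).
move=> lE; apply: (ae_in_imp bad0 _ lE) => x _ nb lx.
by apply: contrapT => b; apply: nb.
Qed.
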